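(* For every $q\in(-1,1)$ and every $\varepsilon>0$ there exist positive integers $N_1,N_2$ such that $$\left|\,q-\frac{\cos\frac{(4N_2-1)\pi}{4N_1+4N_2-2}}{\cos\frac{\pi}{4N_1+4N_2-2}}\right|<\varepsilon .$$ *)

(* Defs.v *)
From Stdlib Require Export Reals.

(* Main.v *)
Require Import Defs.
From Stdlib Require Import Reals.
From Stdlib Require Import Lra Lia ZArith.
Open Scope R_scope.

(** Write [q = cos (t * PI)] with [0 < t < 1], and put [M = N1 + N2] and
    [d = PI / (4 * M - 2)].  The numerator is then [cos ((4 * N2 - 1) * d)] and
    the denominator is [cos d].  For fixed [M] the angles [(4 * N2 - 1) * d] form
    a grid of step [4 * d], so if [4 * N2 * d] is the first multiple of [4 * d]
    above [t * PI], then [(4 * N2 - 1) * d] is within [3 * d] of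
    [t * PI] ([nat_just_above]).  As the cosine is 1-Lipschitz
    ([cos_lipschitz]), the numerator is within [3 * d] of [q] and the denominator
    within [d] of 1, so the quotient is within [8 * d] of [q] once [d <= 1/2]
    ([quotient_close]).  Finally [d] tends to 0 as [M] grows, while [N2] is about
    [t * M], which leaves room for a positive [N1] because [t < 1]. *)

Lemma cos_lipschitz (x y : R) : Rabs (cos x - cos y) <= Rabs (x - y).
Proof.
assert (H : forall a b, a < b -> Rabs (cos a - cos b) <= b - a).
{ intros a b hab.
  destruct (MVT_cor2 cos (fun z => - sin z) a b hab) as [c [e _]].
  { intros z _; apply derivable_pt_lim_cos. }
  rewrite Rabs_minus_sym, e, Rabs_mult, (Rabs_right (b - a)) by lra.
  assert (Rabs (- sin c) <= 1) by (apply Rabs_le; generalize (SIN_bound c); lra).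
  nra. }
destruct (Rtotal_order x y) as [h | [h | h]].
- rewrite (Rabs_minus_sym x y), (Rabs_right (y - x)) by lra; now apply H.
- subst y; rewrite !Rminus_diag, Rabs_R0; lra.
- rewrite Rabs_minus_sym, (Rabs_right (x - y)) by lra; now apply H.
Qed.

Lemma nat_just_above (r : R) : 0 <= r -> exists n : nat, r < INR n <= r + 1.
Proof.
intros hr; destruct (archimed r) as [h1 h2].
exists (Z.to_nat (up r)).
rewrite INR_IZR_INZ, Z2Nat.id; [lra |].
apply le_IZR; lra.
Qed.

Lemma Rabs_le_bounds (a b : R) : Rabs a <= b -> - b <= a <= b.
Proof. unfold Rabs; destruct (Rcase_abs a); lra. Qed.

(** The error is [(q * c - x) / c]; its numerator is at most
    [|q| * |1 - c| + |q - x| <= 4 * d], and [d <= 1/2] keeps [c >= 1/2]. *)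
Lemma quotient_close (q x c d : R) :
  -1 <= q <= 1 -> d <= 1/2 -> Rabs (q - x) <= 3 * d -> Rabs (1 - c) <= d ->
  Rabs (q - x / c) <= 8 * d.
Proof.
intros hq hd hx hc.
apply Rabs_le_bounds in hx; apply Rabs_le_bounds in hc.
assert (hc2 : 1/2 <= c) by lra.
set (y := x / c).
assert (e : x = y * c) by (unfold y; field; lra).
rewrite e in hx.
apply Rabs_le; split; nra.
Qed.

Theorem theorem7p1 :
  forall q : R, -1 < q < 1 ->
  forall eps : R, 0 < eps ->
  exists N1 N2 : nat, (0 < N1)%nat /\ (0 < N2)%nat /\
    Rabs (q - cos ((4 * INR N2 - 1) * PI / (4 * INR N1 + 4 * INR N2 - 2))
              / cos (PI / (4 * INR N1 + 4 * INR N2 - 2))) < eps.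
Proof.
intros q hq eps heps.
assert (hpi := PI_RGT_0).
destruct (acos_bound_lt q hq) as [ha0 ha1].
set (t := acos q / PI).
assert (et : acos q = t * PI) by (unfold t; field; lra).
assert (ht0 : 0 < t) by nra.
assert (ht1 : t < 1) by nra.
assert (hA : 0 < 2 / (1 - t)) by (apply Rdiv_lt_0_compat; lra).
assert (hB : 0 < 9 * PI / eps) by (apply Rdiv_lt_0_compat; lra).
(* The three summands make room for N1, give d <= 1/2, and give 8 * d < eps. *)
destruct (INR_unbounded (2 / (1 - t) + (2 * PI + 1) + 9 * PI / eps)) as [M hM].
assert (hM1 : 2 < INR M * (1 - t)).
{ replace 2 with (2 / (1 - t) * (1 - t)) at 1 by (field; lra).
  apply Rmult_lt_compat_r; lra. }
assert (hM2 : 9 * PI < INR M * eps).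
{ replace (9 * PI) with (9 * PI / eps * eps) by (field; lra).
  apply Rmult_lt_compat_r; lra. }
set (D := 4 * INR M - 2).
assert (hDM : INR M <= D) by (unfold D; lra).
(* The angle 4 * N2 * d lies just above t * PI exactly when N2 lies just above
   t * D / 4. *)
destruct (nat_just_above (t * D / 4)) as [N2 [h1 h2]]; [nra |].
assert (hN2 : INR N2 < INR M) by (unfold D in h2; nra).
assert (hlt : (N2 < M)%nat) by (apply INR_lt; lra).
exists (M - N2)%nat, N2.
split; [lia |].
split; [apply INR_lt; simpl; nra |].
rewrite minus_INR by lia.
replace (4 * (INR M - INR N2) + 4 * INR N2 - 2) with D by (unfold D; ring).
set (d := PI / D).
assert (ed : d * D = PI) by (unfold d; field; lra).
assert (hd : 0 < d) by (apply Rdiv_lt_0_compat; lra).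
apply Rle_lt_trans with (8 * d); [| nra].
apply quotient_close; [lra | nra | |].
- rewrite <- (cos_acos q) by lra.
  apply Rle_trans with (1 := cos_lipschitz _ _).
  replace (acos q - (4 * INR N2 - 1) * PI / D)
    with ((t * D - (4 * INR N2 - 1)) * d)
    by (rewrite et; unfold d; field; lra).
  apply Rabs_le; split; nra.
- rewrite <- cos_0 at 1.
  apply Rle_trans with (1 := cos_lipschitz _ _).
  apply Rabs_le; lra.
Qed.
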